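(* Let $n\ge 1$ and $d\ge 2$ be integers. For every $n$-step process tensor Choi state $\Upsilon$ (as defined in the context), the non-Markovianity satisfies $\mathrm{N}\le 2(n-1)\ln d$, and this value is attained: the maximum of $\mathrm{N}$ over all $n$-step process tensors is $2(n-1)\ln d$.
   Context: An $n$-step process tensor with system dimension $d$ is represented by its Choi state $\Upsilon$, a density operator on $\mathcal{H}_{\mathrm{i}_0}\otimes\mathcal{H}_{\mathrm{o}_1}\otimes\cdots\otimes\mathcal{H}_{\mathrm{i}_{n-1}}\otimes\mathcal{H}_{\mathrm{o}_n}$ (each factor of dimension $d$) satisfying: for all $1\le j\le n$, $\mathrm{tr}_{\mathrm{o}_j}[\Upsilon_{1:j}]=\Upsilon_{1:j-1}\otimes\mathbb{I}_{\mathrm{i}_{j-1}}/d$, where $\Upsilon_{1:j}$ is the partial trace of $\Upsilon$ over $\mathrm{i}_j,\mathrm{o}_{j+1},\dots,\mathrm{i}_{n-1},\mathrm{o}_n$ (with $\Upsilon_{1:n}=\Upsilon$, $\Upsilon_{1:0}=1$). With von Neumann entropies (natural log), $S_j$ the entropy of the marginal of $\Upsilon$ on $\mathrm{i}_{j-1}\mathrm{o}_j$ and $S_{1:n}=S(\Upsilon)$, the non-Markovianity is $\mathrm{N}=\sum_{j=1}^n S_j - S_{1:n}$. *)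

(* Defs.v *)
From mathcomp Require Import all_boot all_algebra.
From mathcomp Require Import reals exp.
From mathcomp Require Import complex.

Set Implicit Arguments.
Unset Strict Implicit.
Unset Printing Implicit Defensive.

Import mathcomp.order.order.Order.TTheory GRing.Theory Num.Theory.
Local Open Scope ring_scope.

Section QInfo.
Variable R : realType.
Local Notation C := (R[i]).

(* An operator on the Hilbert space C^T, given by its matrix entries. *)
Definition op (T : finType) := T -> T -> C.

Definition mx_of (T : finType) (M : op T) : 'M[C]_#|T| :=
  \matrix_(i, j) M (enum_val i) (enum_val j).

Definition trace (T : finType) (M : op T) : C := \sum_(x : T) M x x.

Definition psd (T : finType) (M : op T) : Prop :=
  forall v : T -> C, 0 <= \sum_(x : T) \sum_(y : T) (v x)^* * M x y * v y.

Definition density (T : finType) (M : op T) : Prop :=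
  psd M /\ trace M = 1.

Definition eigenvalues (T : finType) (M : op T) : seq C :=
  sval (closed_field_poly_normal (char_poly (mx_of M))).

(* von Neumann entropy, natural log: S(M) = - sum_l l ln l  (0 ln 0 = 0). *)
Definition vN_entropy (T : finType) (M : op T) : R :=
  - \sum_(l <- eigenvalues M) (complex.Re l * ln (complex.Re l)).

(* ---- multipartite systems: 2n factors, each of dimension d ----------
   Factor k (0 <= k < 2n): factor 2(j-1) is i_{j-1}, factor 2j-1 is o_j. *)
Definition full_idx (n d : nat) := {ffun 'I_(2 * n) -> 'I_d}.

Definition sub_idx (n d : nat) (A : {set 'I_(2 * n)}) :=
  {ffun {k : 'I_(2 * n) | k \in A} -> 'I_d}.

Definition restr (n d : nat) (A : {set 'I_(2 * n)}) (f : full_idx n d)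
  : sub_idx d A := [ffun k => f (val k)].

Arguments restr [n d] A f.
Definition marginal (n d : nat) (A : {set 'I_(2 * n)}) (U : op (full_idx n d))
  : op (sub_idx d A) :=
  fun x y => \sum_(f : full_idx n d) \sum_(g : full_idx n d)
     (if [&& restr A f == x, restr A g == y & restr (~: A) f == restr (~: A) g]
      then U f g else 0).

Arguments marginal [n d] A U _ _.

Definition prefix (n k : nat) : {set 'I_(2 * n)} := [set i : 'I_(2 * n) | i < k]%N.

Definition pair_j (n j : nat) : {set 'I_(2 * n)} :=
  [set i : 'I_(2 * n) | (i == (2 * j - 2)%N :> nat) || (i == (2 * j - 1)%N :> nat)].

(* causality conditions: for 1 <= j <= n,
     tr_{o_j} Y_{1:j} = Y_{1:j-1} (x) I_{i_{j-1}} / d,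
   written entrywise on basis vectors f, g of the full space (every basis
   vector of a subsystem is a restriction of one of the full space).
   tr_{o_j} Y_{1:j} is the marginal on factors 0..2j-2 and Y_{1:j-1} the one
   on factors 0..2j-3 (for j = 1 this is the empty marginal, i.e. the 1x1
   operator tr Y = 1, matching the convention Y_{1:0} = 1). *)
Definition process_tensor (n d : nat) (U : op (full_idx n d)) : Prop :=
  density U /\
  forall j : nat, (1 <= j <= n)%N ->
    forall f g : full_idx n d,
      marginal (prefix n (2 * j - 1)) U
               (restr (prefix n (2 * j - 1)) f) (restr (prefix n (2 * j - 1)) g)
      = marginal (prefix n (2 * j - 2)) U
               (restr (prefix n (2 * j - 2)) f) (restr (prefix n (2 * j - 2)) g)
        * ((([forall k : 'I_(2 * n), ((k : nat) == (2 * j - 2)%N) ==> (f k == g k)])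
             %:R : C) / d%:R).

Definition non_markovianity (n d : nat) (U : op (full_idx n d)) : R :=
  \sum_(1 <= j < n.+1) vN_entropy (marginal (pair_j n j) U) - vN_entropy U.

End QInfo.

(* Main.v *)
(* Upper bound: let T_m be the entropy of the first m factors.  Causality says
   that the input i_{j-1} is maximally mixed and uncorrelated with the past, so
   T_{2j-1} = T_{2j-2} + ln d, while tracing out o_j raises the entropy by at
   most ln d, so T_{2j} >= T_{2j-1} - ln d = T_{2j-2}.  Hence
   S_{1:n} = T_{2n} >= T_2 = S_1, and N is at most the sum over j >= 2 of
   S_j <= 2 ln d.

   Both entropy estimates come from ensembles: if M is the sum of the
   |phi_k><phi_k|, then S(M) is at most the Shannon entropy of the weights
   |phi_k|^2.

   Sharpness: feed the input i_{j-2} to the output o_j, i.e. take a maximally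
   entangled pair on (i_{j-2}, o_j) for 2 <= j <= n and the maximally mixed
   state on o_1 and on i_{n-1}.  Then every S_j is 2 ln d, but S_{1:n} is only
   2 ln d. *)
Require Import Defs.
From mathcomp Require Import all_boot all_algebra.
From mathcomp Require Import reals exp.
From mathcomp Require Import complex.
From mathcomp Require Import ring lra zify.
Import mathcomp.order.order.Order.TTheory GRing.Theory Num.Theory.
Local Open Scope ring_scope.

Set Implicit Arguments.
Unset Strict Implicit.
Unset Printing Implicit Defensive.

(** * Entropy of finite-dimensional operators *)

Section Entropy.
Variable R : realType.
Local Notation C := R[i].
Local Notation "x %:C" := (real_complex R x) (format "x %:C") : ring_scope.

(** * Concavity of the function - x ln x *)

Definition eta (x : R) : R := - (x * ln x).

Lemma eta0 : eta 0 = 0. Proof. by rewrite /eta mul0r oppr0. Qed.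

Lemma eta1 : eta 1 = 0. Proof. by rewrite /eta ln1 mulr0 oppr0. Qed.

Lemma etaM (x y : R) : 0 <= x -> 0 <= y -> eta (x * y) = eta x * y + x * eta y.
Proof.
rewrite le_eqVlt => /predU1P[<-|x0]; first by rewrite !mul0r !eta0 mul0r addr0.
rewrite le_eqVlt => /predU1P[<-|y0]; first by rewrite !mulr0 !eta0 mulr0 addr0.
by rewrite /eta lnM//; ring.
Qed.

(** The right-hand side is the tangent of the concave function [eta] at [r]; the bound is ln u <= u
    - 1 at u = r / q, multiplied by q. *)
Lemma eta_tangent (q r : R) : 0 <= q -> 0 < r -> eta q <= - (q * ln r) + r - q.
Proof.
rewrite le_eqVlt => /predU1P[<- r0|q0 r0].
  by rewrite eta0 mul0r oppr0 add0r addr0 ltW.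
have : ln (r / q) <= r / q - 1.
  have := @le_ln1Dx R (r / q - 1).
  by rewrite [1 + _]addrC subrK; apply; rewrite ltrBrDr addNr divr_gt0.
rewrite ln_div// => /(ler_wpM2l (ltW q0)).
rewrite mulrBr (mulrBr q (r / q)) mulrCA divff ?gt_eqF// !mulr1 /eta.
lra.
Qed.

(** All tangents are taken at the mean Q / #|K|. Splitting a mass Q into #|K| weights thus gains at
    most Q ln #|K|. *)
Lemma sum_eta_le (K : finType) (q : K -> R) : (forall k, 0 <= q k) ->
  \sum_k eta (q k) <= eta (\sum_k q k) + (\sum_k q k) * ln #|K|%:R.
Proof.
move=> q0; set Q := \sum_k q k.
have : 0 <= Q by rewrite sumr_ge0.
rewrite le_eqVlt => /predU1P[Q0|Q0].
  rewrite -Q0 eta0 mul0r addr0 big1// => k _; move/esym/eqP: Q0.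
  by rewrite psumr_eq0// => /allP/(_ k (mem_index_enum k))/eqP ->; rewrite eta0.
have K0 : 0 < (#|K|%:R : R).
  rewrite ltr0n lt0n; apply: contraTneq Q0 => /card0_eq K0.
  by rewrite /Q big_pred0 ?ltxx// => k; have := K0 k.
have le_tangent k : eta (q k) <= - (q k * ln (Q / #|K|%:R)) + Q / #|K|%:R - q k.
  by rewrite eta_tangent ?divr_gt0.
apply: le_trans (ler_sum _ (fun k _ => le_tangent k)) _.
rewrite sumrB big_split /= sumrN -mulr_suml sumr_const -/Q.
rewrite -[(_ / _) *+ _]mulr_natr divfK ?gt_eqF// ln_div// /eta.
by rewrite le_eqVlt; apply/orP; left; apply/eqP; ring.
Qed.

(** * Inner products, sesquilinear forms and positivity *)

Definition sqnorm (z : C) : R := complex.Re z ^+ 2 + complex.Im z ^+ 2.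

Lemma sqnormE z : (sqnorm z)%:C = z * z^*.
Proof. by rewrite /sqnorm add_Re2_Im2 normCK. Qed.

Lemma sqnorm_ge0 z : 0 <= sqnorm z.
Proof. by rewrite addr_ge0 ?sqr_ge0. Qed.

Lemma sqnorm0 : sqnorm 0 = 0.
Proof. by rewrite /sqnorm/= expr0n addr0. Qed.

Lemma conj_real_complex (x : R) : (x%:C)^* = x%:C :> C.
Proof. exact: conjc_real. Qed.

Lemma ler_real_complex (x y : R) : (x%:C <= y%:C :> C) = (x <= y).
Proof. exact: lecR. Qed.

Definition delta (T : finType) (x y : T) : C := (x == y)%:R.

Lemma sum_deltal (T : finType) (F : T -> C) x : \sum_y delta x y * F y = F x.
Proof.
rewrite (bigD1 x)//= /delta eqxx mul1r big1 ?addr0// => y /negbTE.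
by rewrite eq_sym => ->; rewrite mul0r.
Qed.

Lemma deltaC (T : finType) (x y : T) : delta x y = delta y x.
Proof. by rewrite /delta eq_sym. Qed.

Lemma conj_delta (T : finType) (x y : T) : (delta x y)^* = delta x y.
Proof. by rewrite /delta conjC_nat. Qed.

Definition dot (T : finType) (u v : T -> C) : C := \sum_x (u x)^* * v x.

Lemma conj_dot (T : finType) (u v : T -> C) : (dot u v)^* = dot v u.
Proof.
rewrite rmorph_sum; apply: eq_bigr => x _.
by rewrite rmorphM/= conjCK mulrC.
Qed.

Definition qform (T : finType) (M : op R T) (u v : T -> C) : C :=
  \sum_x \sum_y (u x)^* * M x y * v y.

Lemma qform_deltaD (T : finType) (M : op R T) (c : C) x y :
  let v z := delta x z + c * delta y z in
  qform M v v = M x x + c * M x y + (c^* * M y x + c^* * c * M y y).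
Proof.
have inner u : \sum_z M u z * (delta x z + c * delta y z) = M u x + c * M u y.
  rewrite -[in M u x](sum_deltal (M u) x) -(sum_deltal (M u) y) mulr_sumr.
  by rewrite -big_split; apply: eq_bigr => z _ /=; ring.
rewrite /qform /=.
under eq_bigr => u _ do
  under eq_bigr => z _ do rewrite -mulrA.
under eq_bigr => u _ do rewrite -mulr_sumr inner rmorphD rmorphM /= !conj_delta
  mulrDl -mulrA.
by rewrite big_split /= sum_deltal -mulr_sumr sum_deltal; ring.
Qed.

(** Polarization: [0 <= z] over the complex numbers forces z to be real, so the form is real at
    delta_x + c delta_y. The choices c = 1 and c = i then relate the two off-diagonal entries. *)
Lemma psd_herm (T : finType) (M : op R T) : psd M ->
  forall x y, (M x y)^* = M y x.
Proof.
move=> Mpsd x y.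
have real_qf c u v :=
  CrealP (ger0_real (Mpsd (fun z => delta u z + c * delta v z))).
have diag u : (M u u)^* = M u u.
  have := real_qf 0 u u; rewrite -/(qform _ _ _) qform_deltaD.
  by rewrite conjC0 !mul0r !addr0.
have real_off c : c^* * (M x y)^* + c * (M y x)^* = c * M x y + c^* * M y x.
  have := real_qf c x y; rewrite -/(qform _ _ _) qform_deltaD.
  rewrite !rmorphD !rmorphM /= !diag conjCK => H; apply: (addrI (M x x)).
  apply: (addIr (c^* * c * M y y)); rewrite [in RHS]addrA -[RHS]addrA -H; ring.
have := real_off 'i; rewrite conjCi => Hi.
have := real_off 1; rewrite conjC1 => H1.
apply: (@mulfI _ 2); first by rewrite pnatr_eq0.
have /(mulfI (neq0Ci _)) : 'i * ((M y x)^* - (M x y)^*) = 'i * (M x y - M y x) :> C.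
  move: Hi; rewrite !mulNr mulrBr => Hi; rewrite addrC Hi; ring.
move: H1; rewrite !mul1r => H1 H2.
have -> : 2 * (M x y)^* = ((M x y)^* + (M y x)^*) - ((M y x)^* - (M x y)^*) by ring.
by rewrite H1 H2; ring.
Qed.

(** * Spectral decompositions and entropy *)

(** The index type [K] is arbitrary, so product-indexed bases are allowed; orthonormality and
    completeness are both recorded, which spares any dimension count. *)
Definition eigenbasis (T : finType) (M : op R T) (K : finType)
    (l : K -> R) (e : K -> T -> C) :=
  [/\ forall i j, dot (e i) (e j) = delta i j,
      forall x y, \sum_k e k x * (e k y)^* = delta x y &
      forall x y, M x y = \sum_k (l k)%:C * e k x * (e k y)^*].

Lemma char_poly_conjmx (F : fieldType) m (P D : 'M[F]_m) : P \in unitmx ->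
  char_poly (invmx P *m D *m P) = char_poly D.
Proof.
move=> Pu; rewrite /char_poly.
have -> : char_poly_mx (invmx P *m D *m P) =
    map_mx polyC (invmx P) *m char_poly_mx D *m map_mx polyC P.
  rewrite /char_poly_mx mulmxBr mulmxBl !map_mxM /=; congr (_ - _).
  by rewrite scalar_mxC -mulmxA -map_mxM mulVmx// map_mx1 mulmx1.
by rewrite !det_mulmx mulrAC -det_mulmx -map_mxM mulVmx// map_mx1 det1 mul1r.
Qed.

(** [eigenvalues] is only known as the root list of the characteristic polynomial, hence equality up
    to order. *)
Lemma eigenvalues_diag (T : finType) (M : op R T) (P : 'M[C]_#|T|) D :
  P \in unitmx -> mx_of M = invmx P *m diag_mx D *m P ->
  perm_eq (eigenvalues M) [seq D 0 i | i : 'I_#|T|].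
Proof.
move=> Pu MD; rewrite /eigenvalues; case: closed_field_poly_normal => s /= ps.
apply: prod_XsubC_eq; rewrite big_image /=.
move: ps; rewrite (monicP (char_poly_monic _)) scale1r => <-.
rewrite MD char_poly_conjmx// char_poly_trig ?diag_mx_is_trig//.
by apply: eq_bigr => i _; rewrite mxE eqxx mulr1n.
Qed.

(** The vectors [e k] are arbitrary: this serves eigenbases and, with all coefficients 1,
    ensembles. *)
Lemma qform_sum (T K : finType) (M : op R T) (c : K -> C) (e : K -> T -> C) u v :
  (forall x y, M x y = \sum_k c k * e k x * (e k y)^*) ->
  qform M u v = \sum_k c k * (dot u (e k) * dot (e k) v).
Proof.
move=> ME; rewrite /qform.
under eq_bigr => x _ do under eq_bigr => y _ do rewrite ME mulr_sumr mulr_suml.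
under eq_bigr => x _ do rewrite exchange_big /=.
rewrite exchange_big /=; apply: eq_bigr => k _.
rewrite /dot mulr_suml mulr_sumr; apply: eq_bigr => x _.
by rewrite !mulr_sumr; apply: eq_bigr => y _; ring.
Qed.

(** A hermitian matrix is normal, hence unitarily diagonalizable; each eigenvalue is the value of
    the form at its eigenvector, hence nonnegative. *)
Lemma psd_spectral (T : finType) (M : op R T) : psd M ->
  exists (l : 'I_#|T| -> R) (e : 'I_#|T| -> T -> C),
    [/\ eigenbasis M l e, forall i, 0 <= l i &
        vN_entropy M = \sum_i eta (l i)].
Proof.
move=> Mpsd; have Mherm := psd_herm Mpsd.
have Mnormal : mx_of M \is normalmx.
  have MH : map_mx Num.conj (mx_of M)^T = mx_of M.
    by apply/matrixP => i j; rewrite !mxE Mherm.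
  by apply/normalmxP; rewrite MH.
have := orthomx_spectralP Mnormal.
set P := spectralmx _; set D := spectral_diag _ => MD.
have Punit : P \is unitarymx := spectral_unitarymx _.
(* In M = P^-1 D P with P unitary, the eigenvectors are the columns of P^-1, that is, the conjugated
   rows of P. *)
pose e i x := (P i (enum_rank x))^*.
have eonb i j : dot (e i) (e j) = delta i j.
  move/unitarymxP: Punit => /matrixP/(_ i j); rewrite !mxE /delta => <-.
  rewrite /dot (reindex (fun k : 'I_#|T| => enum_val k)) /=; last exact/onW_bij/enum_val_bij.
  by apply: eq_bigr => k _; rewrite /e !mxE enum_valK conjCK.
have ecomp x y : \sum_k e k x * (e k y)^* = delta x y.
  have := mulVmx (unitarymx_unit Punit); rewrite invmx_unitary//.
  move/matrixP/(_ (enum_rank x) (enum_rank y)); rewrite !mxE.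
  rewrite (inj_eq enum_rank_inj) /delta => <-.
  by apply: eq_bigr => k _; rewrite /e !mxE conjCK.
have edec x y : M x y = \sum_k D 0 k * e k x * (e k y)^*.
  move/matrixP: MD => /(_ (enum_rank x) (enum_rank y)).
  rewrite !mxE !enum_rankK => ->; apply: eq_bigr => k _.
  rewrite invmx_unitary// /e conjCK; congr (_ * _).
  rewrite mxE (bigD1 k)//= big1 ?addr0 => [|i /negbTE ik].
    by rewrite !mxE eqxx mulr1n mulrC.
  by rewrite !mxE ik mulr0n mulr0.
have D0 i : 0 <= D 0 i.
  have := Mpsd (e i); rewrite -/(qform M (e i) (e i)).
  suff -> : qform M (e i) (e i) = D 0 i by [].
  rewrite (qform_sum _ _ edec).
  under eq_bigr => k _ do rewrite !eonb (deltaC k i) mulrCA.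
  by rewrite sum_deltal /delta eqxx mulr1.
have DE i : D 0 i = (complex.Re (D 0 i))%:C by rewrite RRe_real ?ger0_real.
exists (fun i => complex.Re (D 0 i)), e; split.
- by split=> // x y; rewrite edec; apply: eq_bigr => k _; rewrite -DE.
- by move=> i; rewrite -ler_real_complex -DE.
- rewrite /vN_entropy (perm_big _ (eigenvalues_diag (unitarymx_unit Punit) MD)).
  by rewrite big_image /= -sumrN.
Qed.

Lemma dot_suml (T K : finType) (a : K -> C) (e : K -> T -> C) u :
  dot (fun x => \sum_k a k * e k x) u = \sum_k (a k)^* * dot (e k) u.
Proof.
rewrite /dot; under eq_bigr => x _ do rewrite rmorph_sum mulr_suml.
rewrite exchange_big /=; apply: eq_bigr => k _; rewrite mulr_sumr.
by apply: eq_bigr => x _; rewrite rmorphM mulrA.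
Qed.

Lemma sqnorm_dot (T : finType) (u v : T -> C) :
  (sqnorm (dot u v))%:C = dot v u * dot u v.
Proof. by rewrite sqnormE conj_dot mulrC. Qed.

Lemma sqnorm_dotC (T : finType) (u v : T -> C) : sqnorm (dot u v) = sqnorm (dot v u).
Proof. by apply: (@complexI R); rewrite !sqnorm_dot mulrC. Qed.

Definition sqlen (T : finType) (u : T -> C) : R := \sum_x sqnorm (u x).

Lemma sqlenE (T : finType) (u : T -> C) : (sqlen u)%:C = dot u u.
Proof.
by rewrite /sqlen rmorph_sum /=; apply: eq_bigr => x _; rewrite sqnormE mulrC.
Qed.

Lemma sqlen_ge0 (T : finType) (u : T -> C) : 0 <= sqlen u.
Proof. by apply: sumr_ge0 => x _; apply: sqnorm_ge0. Qed.

Section Eigenbasis.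
Variables (T : finType) (M : op R T) (K : finType) (l : K -> R) (e : K -> T -> C).
Hypothesis Me : eigenbasis M l e.

(** Completeness writes the identity [delta] as the sum of the |e_k><e_k|, which is inserted between
    u and v. *)
Lemma dot_parseval (u v : T -> C) :
  \sum_k dot u (e k) * dot (e k) v = dot u v.
Proof.
have [_ ecomp _] := Me.
transitivity (qform (@delta T) u v).
  rewrite (@qform_sum _ K _ (fun=> 1) e) => [|x y].
    by apply: eq_bigr => k _; rewrite mul1r.
  by rewrite -ecomp; apply: eq_bigr => k _; rewrite mul1r.
apply: eq_bigr => x _; under eq_bigr => y _ do rewrite -mulrA.
by rewrite -mulr_sumr sum_deltal.
Qed.

Lemma sqnorm_parseval (u : T -> C) : \sum_k sqnorm (dot (e k) u) = sqlen u.
Proof.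
apply: (@complexI R); rewrite rmorph_sum sqlenE -dot_parseval /=.
by apply: eq_bigr => k _; rewrite sqnorm_dot.
Qed.

Lemma eigen_qform u v : qform M u v = \sum_k (l k)%:C * (dot u (e k) * dot (e k) v).
Proof. by have [_ _ MD] := Me; apply: qform_sum. Qed.

Lemma eigen_qforml k v : qform M (e k) v = (l k)%:C * dot (e k) v.
Proof.
have [eonb _ _] := Me; rewrite eigen_qform.
by under eq_bigr => i _ do rewrite eonb mulrCA; rewrite sum_deltal.
Qed.

Lemma eigen_qformr u k : qform M u (e k) = (l k)%:C * dot u (e k).
Proof.
have [eonb _ _] := Me; rewrite eigen_qform.
by under eq_bigr => i _ do rewrite eonb mulrA mulrC (deltaC i); rewrite sum_deltal.
Qed.

Lemma eigen_trace : (\sum_k l k)%:C = trace M.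
Proof.
have [eonb _ MD] := Me; rewrite /trace rmorph_sum /=.
under [RHS]eq_bigr => x _ do rewrite MD.
rewrite exchange_big; apply: eq_bigr => k _ /=.
under eq_bigr => x _ do rewrite -mulrA [e k x * _]mulrC.
by rewrite -mulr_sumr -/(dot (e k) (e k)) eonb /delta eqxx mulr1.
Qed.

Lemma eigen_psd : (forall k, 0 <= l k) -> psd M.
Proof.
move=> l0 v; rewrite -/(qform M v v) eigen_qform sumr_ge0// => k _.
by rewrite -sqnorm_dot -rmorphM/= (ler_real_complex 0) mulr_ge0 ?sqnorm_ge0.
Qed.

End Eigenbasis.

(* Eigenvectors with nonzero overlap share their eigenvalue, and the squared
   overlaps of two eigenbases form a doubly stochastic matrix. *)
Lemma eigenbasis_unique (T K I : finType) (M : op R T) (l : K -> R) (e : K -> T -> C)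
    (m : I -> R) (f : I -> T -> C) (F : R -> R) :
  eigenbasis M l e -> eigenbasis M m f -> \sum_k F (l k) = \sum_i F (m i).
Proof.
move=> Me Mf.
have unit_len (J : finType) n (g : J -> T -> C) j : eigenbasis M n g -> sqlen (g j) = 1.
  move=> [gonb _ _]; apply: (@complexI R); rewrite sqlenE gonb /delta eqxx.
  by rewrite rmorph1.
have overlap k i : F (l k) * sqnorm (dot (e k) (f i)) = F (m i) * sqnorm (dot (e k) (f i)).
  have := eigen_qforml Me k (f i); rewrite (eigen_qformr Mf) => /eqP.
  rewrite -subr_eq0 -mulrBl mulf_eq0 -rmorphB /= => /orP[|/eqP->]; last first.
    by rewrite sqnorm0 !mulr0.
  by rewrite (fmorph_eq0 (real_complex R)) subr_eq0 => /eqP ->.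
transitivity (\sum_k \sum_i F (l k) * sqnorm (dot (e k) (f i))).
  apply: eq_bigr => k _; rewrite -mulr_sumr.
  under eq_bigr => i _ do rewrite sqnorm_dotC.
  by rewrite (sqnorm_parseval Mf) (unit_len _ _ _ _ Me) mulr1.
rewrite exchange_big /=; apply: eq_bigr => i _.
under eq_bigr => k _ do rewrite overlap.
by rewrite -mulr_sumr (sqnorm_parseval Me) (unit_len _ _ _ _ Mf) mulr1.
Qed.

(** Any eigenbasis computes the entropy, so exhibiting a convenient one suffices. *)
Lemma eigenbasis_entropy (T K : finType) (M : op R T) (l : K -> R) (e : K -> T -> C) :
  (forall k, 0 <= l k) -> eigenbasis M l e -> vN_entropy M = \sum_k eta (l k).
Proof.
move=> l0 Me; have [m [f [Mf _ ->]]] := psd_spectral (eigen_psd Me l0).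
exact: eigenbasis_unique Mf Me.
Qed.

Lemma vN_entropy_bij (T T' : finType) (M : op R T) (h : T' -> T) : psd M ->
  bijective h -> vN_entropy (fun x y => M (h x) (h y)) = vN_entropy M.
Proof.
move=> Mpsd hbij; have [l [e [[eonb ecomp MD] l0 ->]]] := psd_spectral Mpsd.
apply: (@eigenbasis_entropy _ _ _ _ (fun k x => e k (h x))) => //; split=> //.
- by move=> i j; rewrite -eonb /dot [RHS](reindex h)//=; apply: onW_bij.
- by move=> x y; rewrite ecomp /delta (bij_eq hbij).
Qed.

(** The products of the eigenvectors of [M] with the standard basis of [B] form an eigenbasis of
    [N]: each eigenvalue l becomes l / #|B|, repeated #|B| times. *)
Lemma vN_entropy_tensor_mixed (A B : finType) (M : op R A) (N : op R (A * B)%type) :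
  density M -> (0 < #|B|)%N ->
  (forall x y, N x y = M x.1 y.1 * (delta x.2 y.2 / #|B|%:R)) ->
  vN_entropy N = vN_entropy M + ln #|B|%:R.
Proof.
move=> [Mpsd Mtr] B0 NE.
have [l [e [Me l0 ->]]] := psd_spectral Mpsd; have [eonb ecomp MD] := Me.
have B1 : 0 < (#|B|%:R : R) by rewrite ltr0n.
rewrite (@eigenbasis_entropy _ ('I_#|A| * B)%type _ (fun p => l p.1 / #|B|%:R)
  (fun p x => e p.1 x.1 * delta p.2 x.2)) => [|p|]; last 2 first.
- by rewrite divr_ge0.
- split.
  + move=> [i b] [j c]; rewrite /dot /= -(pair_bigA _ (fun x y =>
      (e i x * delta b y)^* * (e j x * delta c y))) /=.
    transitivity (\sum_x ((e i x)^* * e j x) * \sum_y delta b y * delta c y).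
      apply: eq_bigr => x _; rewrite mulr_sumr; apply: eq_bigr => y _.
      by rewrite rmorphM/= conj_delta; ring.
    rewrite sum_deltal -mulr_suml -/(dot (e i) (e j)) eonb.
    by rewrite /delta -natrM mulnb xpair_eqE (eq_sym c).
  + move=> [x b] [y c] /=; rewrite -(pair_bigA _ (fun k d =>
      (e k x * delta d b) * (e k y * delta d c)^*)) /=.
    transitivity (\sum_k (e k x * (e k y)^*) * \sum_d delta b d * delta d c).
      apply: eq_bigr => k _; rewrite mulr_sumr; apply: eq_bigr => d _.
      by rewrite rmorphM/= conj_delta (deltaC b); ring.
    rewrite sum_deltal -mulr_suml ecomp.
    by rewrite /delta -natrM mulnb xpair_eqE.
  + move=> [x b] [y c] /=; rewrite NE /= -(pair_bigA _ (fun k d =>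
      (l k / #|B|%:R)%:C * (e k x * delta d b) * (e k y * delta d c)^*)) /=.
    transitivity (\sum_k ((l k)%:C * e k x * (e k y)^*) *
                  (#|B|%:R^-1 * \sum_d delta b d * delta d c)).
      by rewrite sum_deltal -mulr_suml -MD [_ / _]mulrC.
    apply: eq_bigr => k _; rewrite !mulr_sumr; apply: eq_bigr => d _.
    rewrite !rmorphM/= fmorphV rmorph_nat conj_delta (deltaC b); ring.
rewrite -(pair_bigA _ (fun k d => eta (l k / #|B|%:R))) /=.
(* Trace one spreads ln #|B| over the eigenvalues, so the identity can be checked for each of
   them. *)
have -> : ln #|B|%:R = \sum_k (l k * ln #|B|%:R).
  rewrite -mulr_suml; suff -> : \sum_k l k = 1 by rewrite mul1r.
  by apply: (@complexI R); rewrite (eigen_trace Me) Mtr rmorph1.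
rewrite -big_split; apply: eq_bigr => k _ /=.
have -> : \sum_(b : B) eta (l k / #|B|%:R) = eta (l k / #|B|%:R) * #|B|%:R.
  by rewrite sumr_const mulr_natr.
rewrite etaM// ?invr_ge0 ?ltW// mulrDl divfK ?gt_eqF//.
by rewrite /eta lnV// !mulrN opprK [_^-1 * _]mulrC -!mulrA mulVf ?gt_eqF// mulr1.
Qed.

(** * Entropy bounds from ensembles *)

Lemma ensemble_psd (T K : finType) (M : op R T) (phi : K -> T -> C) :
  (forall x y, M x y = \sum_k phi k x * (phi k y)^*) -> psd M.
Proof.
move=> ME v; rewrite -/(qform M v v) (@qform_sum _ K _ (fun=> 1) phi) => [|x y].
  apply: sumr_ge0 => k _.
  by rewrite mul1r -sqnorm_dot (ler_real_complex 0) sqnorm_ge0.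
by rewrite ME; apply: eq_bigr => k _; rewrite mul1r.
Qed.

(** The squared overlaps [s i k] have row sums l_i and column sums |phi_k|^2. Dividing rows by l_i
    gives weights [w] with column sums at most 1, and concavity of [eta] applies column by
    column. *)
Lemma ensemble_entropy (T K : finType) (M : op R T) (phi : K -> T -> C) :
  (forall x y, M x y = \sum_k phi k x * (phi k y)^*) ->
  vN_entropy M <= \sum_k eta (sqlen (phi k)).
Proof.
move=> ME; have [l [e [Me l0 ->]]] := psd_spectral (ensemble_psd ME).
have [eonb ecomp MD] := Me.
have Mqf u : qform M u u = (\sum_k sqnorm (dot (phi k) u))%:C.
  rewrite (@qform_sum _ K _ (fun=> 1) phi) => [|x y].
    by rewrite rmorph_sum; apply: eq_bigr => k _ /=; rewrite mul1r sqnorm_dot.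
  by rewrite ME; apply: eq_bigr => k _; rewrite mul1r.
pose s i k := sqnorm (dot (e i) (phi k)).
have s0 i k : 0 <= s i k by apply: sqnorm_ge0.
have suml i : \sum_k s i k = l i.
  apply: (@complexI R); under eq_bigr => k _ do rewrite /s sqnorm_dotC.
  by rewrite -Mqf (eigen_qforml Me) eonb /delta eqxx mulr1.
have sumq k : \sum_i s i k = sqlen (phi k) by rewrite (sqnorm_parseval Me).
pose w i k := s i k / l i.
have w0 i k : 0 <= w i k by rewrite divr_ge0.
(* If l_i = 0, division by zero makes [w i k] vanish, and [s i k] vanishes too because its row sums
   to 0. *)
have sE i k : w i k * l i = s i k.
  have [li0|/divfK -> //] := eqVneq (l i) 0; rewrite li0 mulr0.
  move: (suml i); rewrite li0 => /eqP; rewrite psumr_eq0// => /allP.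
  by move/(_ k (mem_index_enum k))/eqP.
(* [\sum_i w i k = <phi_k| M^-1 |phi_k>], which is at most 1 because
   [M] dominates [|phi_k><phi_k|]; test this domination on [v = M^-1 phi_k]. *)
have w1 k : \sum_i w i k <= 1.
  set W := \sum_i _; have W0 : 0 <= W by apply: sumr_ge0.
  pose a i := dot (e i) (phi k) / (l i)%:C.
  have conja i : (a i)^* = dot (phi k) (e i) / (l i)%:C.
    by rewrite /a rmorphM fmorphV /= conj_real_complex conj_dot.
  pose v x := \sum_i a i * e i x.
  have vE u : dot v u = \sum_i (a i)^* * dot (e i) u by rewrite dot_suml.
  have wE i : (w i k)%:C = (a i)^* * dot (e i) (phi k).
    by rewrite conja /w rmorphM fmorphV /= sqnorm_dot mulrAC.
  have vphi : dot v (phi k) = W%:C.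
    by rewrite vE rmorph_sum; apply: eq_bigr => i _ /=; rewrite wE.
  have vMv : qform M v v = W%:C.
    rewrite (eigen_qform Me) rmorph_sum; apply: eq_bigr => i _ /=.
    have ve : dot v (e i) = (a i)^*.
      by rewrite vE; under eq_bigr => j _ do rewrite eonb mulrC (deltaC j);
         rewrite sum_deltal.
    rewrite -(conj_dot v) ve conjCK wE /a.
    have [li0|li0] := eqVneq (l i) 0; first by rewrite conja li0 rmorph0 invr0 !mulr0 !mul0r.
    by rewrite mulrCA [_%:C * (_ / _)]mulrC divfK// fmorph_eq0.
  have : W ^+ 2 <= W.
    have := Mqf v; rewrite vMv => /complexI => {2}->.
    rewrite (bigD1 k)//= -[X in X <= _]addr0 lerD ?sumr_ge0// => [|i _]; last first.
      exact: sqnorm_ge0.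
    by rewrite -ler_real_complex sqnorm_dot -(conj_dot v) vphi conj_real_complex rmorphXn expr2.
  by rewrite expr2 -subr_ge0 -{1}[W]mulr1 -mulrBr; nra.
apply: (@le_trans _ _ (\sum_i \sum_k w i k * eta (l i))).
  apply: ler_sum => i _; rewrite -mulr_suml -mulr_suml suml.
  have [->|li0] := eqVneq (l i) 0; first by rewrite eta0 mulr0.
  by rewrite divff// mul1r.
rewrite exchange_big /=; apply: ler_sum => k _.
have : 0 <= sqlen (phi k) by apply: sqlen_ge0.
rewrite le_eqVlt => /predU1P[q0|q0].
  rewrite -q0 eta0 big1// => i _; suff -> : w i k = 0 by rewrite mul0r.
  move: (sumq k); rewrite -q0 => /eqP; rewrite psumr_eq0// => /allP.
  by move/(_ i (mem_index_enum i))/eqP => sik; rewrite /w sik mul0r.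
set q := sqlen (phi k) in q0 *.
(* Tangent at q, weighted by [w]. Summed over i, it gives eta q + (W - 1) q, where W <= 1 is the
   column sum of [w]. *)
have tangent i : w i k * eta (l i) <= - (s i k * ln q) + w i k * q - s i k.
  rewrite -sE; have /(ler_wpM2l (w0 i k)) := eta_tangent (l0 i) q0; lra.
apply: le_trans (ler_sum _ (fun i _ => tangent i)) _.
rewrite sumrB big_split /= sumrN -!mulr_suml sumq -/q /eta.
have := ler_wpM2r (ltW q0) (w1 k); rewrite mul1r; lra.
Qed.

Lemma vN_entropy_le (T : finType) (M : op R T) : density M ->
  vN_entropy M <= ln #|T|%:R.
Proof.
move=> [Mpsd Mtr]; have [l [e [Me l0 ->]]] := psd_spectral Mpsd.
have l1 : \sum_i l i = 1 by apply: (@complexI R); rewrite (eigen_trace Me) Mtr.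
apply: le_trans (sum_eta_le l0) _.
by rewrite l1 eta1 add0r mul1r card_ord.
Qed.

Lemma sqlen_trace (T K : finType) (M : op R T) (phi : K -> T -> C) :
  (forall x y, M x y = \sum_k phi k x * (phi k y)^*) ->
  (\sum_k sqlen (phi k))%:C = trace M.
Proof.
move=> ME; rewrite rmorph_sum /trace /= -[in RHS](eq_bigr _ (fun x _ => esym (ME x x))).
rewrite exchange_big; apply: eq_bigr => k _ /=.
by rewrite sqlenE; apply: eq_bigr => x _; rewrite mulrC.
Qed.

(** A rank bound: only the number of vectors in the ensemble matters. *)
Lemma ensemble_entropy_le (T K : finType) (M : op R T) (phi : K -> T -> C) :
  trace M = 1 -> (forall x y, M x y = \sum_k phi k x * (phi k y)^*) ->
  vN_entropy M <= ln #|K|%:R.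
Proof.
move=> Mtr ME; apply: le_trans (ensemble_entropy ME) _.
have q1 : \sum_k sqlen (phi k) = 1.
  by apply: (@complexI R); rewrite (sqlen_trace ME) Mtr.
apply: le_trans (sum_eta_le (fun k => sqlen_ge0 (phi k))) _.
by rewrite q1 eta1 add0r mul1r.
Qed.

(* Slicing the eigenvectors of [N] along [B] gives an ensemble for [M]; each
   eigenvalue splits into at most [#|B|] weights. *)
Lemma vN_entropy_partial_trace (A B : finType) (M : op R A) (N : op R (A * B)%type) :
  density N -> (forall x y, M x y = \sum_b N (x, b) (y, b)) ->
  vN_entropy M <= vN_entropy N + ln #|B|%:R.
Proof.
move=> [Npsd Ntr] ME; have [l [e [Ne l0 ->]]] := psd_spectral Npsd.
have [eonb ecomp ND] := Ne.
have sqrtE k : (Num.sqrt (l k))%:C * (Num.sqrt (l k))%:C = (l k)%:C.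
  by rewrite -rmorphM /= -expr2 sqr_sqrtr.
(* The square root absorbs the eigenvalue into the vector, as ensembles carry no coefficients. *)
pose phi (p : 'I_#|{: A * B}| * B) x := (Num.sqrt (l p.1))%:C * e p.1 (x, p.2).
have phiE x y : M x y = \sum_p phi p x * (phi p y)^*.
  rewrite ME -(pair_bigA _ (fun k b => phi (k, b) x * (phi (k, b) y)^*)) /=.
  rewrite exchange_big; apply: eq_bigr => b _ /=.
  rewrite ND; apply: eq_bigr => k _.
  by rewrite /phi rmorphM/= conj_real_complex -sqrtE; ring.
apply: le_trans (ensemble_entropy phiE) _.
rewrite -(pair_bigA _ (fun k b => eta (sqlen (phi (k, b))))) /=.
have phil k : \sum_b sqlen (phi (k, b)) = l k.
  apply: (@complexI R); rewrite rmorph_sum /=.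
  transitivity ((l k)%:C * dot (e k) (e k)); last by rewrite eonb /delta eqxx mulr1.
  under eq_bigr => b _ do rewrite sqlenE.
  rewrite exchange_big /= pair_bigA /= /dot mulr_sumr; apply: eq_bigr => -[x b] _.
  by rewrite /phi rmorphM/= conj_real_complex -sqrtE; ring.
have lnB : ln #|B|%:R = \sum_k l k * ln #|B|%:R.
  rewrite -mulr_suml; suff -> : \sum_k l k = 1 by rewrite mul1r.
  by apply: (@complexI R); rewrite (eigen_trace Ne) Ntr rmorph1.
rewrite lnB -big_split; apply: ler_sum => k _ /=.
by rewrite -[in X in _ <= X](phil k) sum_eta_le// => b; apply: sqlen_ge0.
Qed.

End Entropy.

(** * Marginals *)

Section Marginals.
Variables (R : realType) (n d : nat).
Local Notation C := R[i].
Local Notation idx := (full_idx n d).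
Local Notation marg A U := (@marginal R n d A U).
Implicit Types (A : {set 'I_(2 * n)}) (f g : idx) (U : op R idx).

Lemma restrP A f g : reflect {in A, f =1 g} (restr A f == restr A g).
Proof.
apply: (iffP eqP) => [/ffunP fg k kA|fg].
  by have := fg (Sub k kA); rewrite !ffunE.
by apply/ffunP => -[k kA]; rewrite !ffunE; apply: fg.
Qed.

Lemma restr_full A f g : (restr A f == restr A g) && (restr (~: A) f == restr (~: A) g) = (f == g).
Proof.
apply/andP/eqP => [[/restrP fg /restrP fg']|->//]; apply/ffunP => k.
by have [kA|kA] := boolP (k \in A); [apply: fg|apply: fg'; rewrite inE].
Qed.

Lemma restr_setU1 A k f g :
  (restr (k |: A) f == restr (k |: A) g) = (restr A f == restr A g) && (f k == g k).
Proof.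
apply/restrP/andP => [fg|[/restrP fg /eqP fgk] i].
  by split; [apply/restrP => i iA; apply: fg; rewrite inE iA orbT|
             apply/eqP/fg; rewrite setU11].
by rewrite !inE => /predU1P[->//|]; apply: fg.
Qed.

Lemma restr_setC1 A k f g : k \notin A ->
  (restr (~: A) f == restr (~: A) g) =
  (restr (~: (k |: A)) f == restr (~: (k |: A)) g) && (f k == g k).
Proof.
move=> kA; rewrite -restr_setU1; congr (restr _ f == restr _ g).
by apply/setP => i; rewrite !inE; case: eqVneq => // ->; rewrite kA.
Qed.

Lemma marginal_density A U : density U -> density (marg A U).
Proof.
move=> [Upsd Utr]; split=> [v|].
  rewrite /marginal.
  (* [w z] is v tensored with the basis vector z of the traced-out factors; the form of the marginal
     at v is the sum over z of the form of [U] at [w z]. *)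
  pose w z f : C := (restr (~: A) f == z)%:R * v (restr A f).
  suff -> : \sum_x \sum_y (v x)^* * marg A U x y * v y =
            \sum_z \sum_f \sum_g (w z f)^* * U f g * w z g.
    by apply: sumr_ge0 => z _; apply: Upsd.
  transitivity (\sum_f \sum_g (restr (~: A) f == restr (~: A) g)%:R *
     ((v (restr A f))^* * U f g * v (restr A g))).
    transitivity (\sum_f \sum_g \sum_x \sum_y (restr (~: A) f == restr (~: A) g)%:R *
       (delta R (restr A f) x * (delta R (restr A g) y * ((v x)^* * U f g * v y)))).
      under [RHS]eq_bigr => f _ do rewrite exchange_big /=.
      rewrite [RHS]exchange_big; apply: eq_bigr => x _ /=.
      under [RHS]eq_bigr => f _ do rewrite exchange_big /=.
      rewrite [RHS]exchange_big; apply: eq_bigr => y _ /=.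
      rewrite /marginal mulr_sumr mulr_suml; apply: eq_bigr => f _.
      rewrite mulr_sumr mulr_suml; apply: eq_bigr => g _; rewrite /delta.
      do 3 case: eqP => _ //=; rewrite ?(mul0r, mulr0, mul1r) //.
    apply: eq_bigr => f _; apply: eq_bigr => g _.
    under eq_bigr => x _ do rewrite -!mulr_sumr sum_deltal.
    by rewrite -mulr_sumr sum_deltal.
  rewrite [RHS]exchange_big; apply: eq_bigr => f _ /=.
  rewrite exchange_big; apply: eq_bigr => g _ /=.
  rewrite (bigD1 (restr (~: A) f))//= big1 => [|z /negbTE fz]; last first.
    by rewrite /w eq_sym fz mul0r conjC0 !mul0r.
  rewrite /w eqxx mul1r addr0 eq_sym.
  by case: eqP => _; rewrite ?(mul0r, mulr0, mul1r).
rewrite -Utr /trace /marginal.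
rewrite exchange_big; apply: eq_bigr => f _ /=.
rewrite exchange_big (bigD1 f)//= [X in _ + X]big1 ?addr0 => [|g fg].
  rewrite (bigD1 (restr A f))//= eqxx big1 ?addr0 ?eqxx// => x /negbTE fx.
  by rewrite eq_sym fx.
apply: big1 => x _; case: ifP => // /and3P[/eqP <- gf cgf].
by move: fg; rewrite -(restr_full A) gf eq_sym cgf.
Qed.

Lemma density_bij (T T' : finType) (M : op R T) (h : T' -> T) : bijective h ->
  density M -> density (fun x y => M (h x) (h y)).
Proof.
move=> hbij [Mpsd Mtr]; split=> [v|]; last first.
  by rewrite -Mtr /trace [RHS](reindex h)//=; apply: onW_bij.
have [h' hK h'K] := hbij; have := Mpsd (v \o h'); rewrite (reindex h (onW_bij _ hbij)) /=.
under eq_bigr => x _ do rewrite (reindex h (onW_bij _ hbij)) /=.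
by under eq_bigr => x _ do under eq_bigr => y _ do rewrite !hK.
Qed.

(** Operators are functions, but the entropy sees only their matrices, so pointwise equality is
    enough. *)
Lemma eq_vN_entropy (T : finType) (M N : op R T) : (forall x y, M x y = N x y) ->
  vN_entropy M = vN_entropy N.
Proof.
move=> MN; rewrite /vN_entropy /eigenvalues.
by have -> : mx_of M = mx_of N by apply/matrixP => i j; rewrite !mxE.
Qed.

(** * Adjoining one factor to a marginal *)

Section Extension.
Variable i0 : 'I_d.

(** A section of [restr A]; the factors outside [A] receive the arbitrary level [i0]. *)
Definition extend A (x : sub_idx d A) : idx := [ffun k => oapp x i0 (insub k)].

Lemma extendK A : cancel (@extend A) (@restr n d A).
Proof. by move=> x; apply/ffunP => k; rewrite !ffunE valK. Qed.

(** Identifies the basis of [k |: A] with a product, so that the bipartite entropy lemmas apply to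
    marginals. *)
Definition glue A k (p : sub_idx d A * 'I_d) : sub_idx d (k |: A) :=
  restr (k |: A) [ffun i => if i == k then p.2 else extend p.1 i].

Lemma glueE A k f p : k \notin A ->
  (restr (k |: A) f == glue k p) = (restr A f == p.1) && (f k == p.2).
Proof.
move=> kA; rewrite /glue restr_setU1 ffunE eqxx -[X in _ = (_ == X) && _]extendK.
congr (_ && _); apply/restrP/restrP => fp i iA; rewrite fp// !ffunE;
  by rewrite (negbTE (memPn kA _ iA)).
Qed.

Lemma glue_bij A k : k \notin A -> bijective (@glue A k).
Proof.
move=> kA; exists (fun z => (restr A (extend z), extend z k)) => [[x b]|z].
  have := eqxx (glue k (x, b)); rewrite -{1}[glue k (x, b)]extendK glueE//=.
  by move=> /andP[/eqP-> /eqP->].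
by apply/esym/eqP; rewrite -{1}[z]extendK glueE// !eqxx.
Qed.

Lemma marginal_glue A k U x y : k \notin A ->
  marg A U x y = \sum_b marg (k |: A) U (glue k (x, b)) (glue k (y, b)).
Proof.
move=> kA; rewrite /marginal [RHS]exchange_big; apply: eq_bigr => f _ /=.
rewrite [RHS]exchange_big; apply: eq_bigr => g _ /=.
under [RHS]eq_bigr => b _ do rewrite !glueE//=.
rewrite (restr_setC1 _ _ kA) (bigD1 (f k))//= big1 ?addr0 => [|b /negbTE fb].
  rewrite eqxx andbT (eq_sym (g k)).
  by do 4 case: (_ == _).
by rewrite (eq_sym (f k)) fb andbF.
Qed.

Lemma marginal_entropy_setU1 A k U : density U -> k \notin A ->
  vN_entropy (marg A U) <= vN_entropy (marg (k |: A) U) + ln d%:R.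
Proof.
move=> Ud kA; have [Npsd _] := marginal_density (k |: A) Ud.
rewrite -(vN_entropy_bij Npsd (glue_bij kA)) -[in ln _](card_ord d).
apply: vN_entropy_partial_trace => [|x y]; last by rewrite (marginal_glue _ _ _ kA).
by apply: density_bij; [apply: glue_bij|apply: marginal_density].
Qed.

(** The hypothesis is phrased with restrictions of full basis vectors to match the causality
    condition. *)
Lemma marginal_entropy_mixed A k U : density U -> k \notin A ->
  (forall f g, marg (k |: A) U (restr (k |: A) f) (restr (k |: A) g) =
     marg A U (restr A f) (restr A g) * ((f k == g k)%:R / d%:R)) ->
  vN_entropy (marg (k |: A) U) = vN_entropy (marg A U) + ln d%:R.
Proof.
move=> Ud kA AkE; have [Npsd _] := marginal_density (k |: A) Ud.
rewrite -(vN_entropy_bij Npsd (glue_bij kA)) -[in ln _](card_ord d).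
apply: vN_entropy_tensor_mixed => [||[x b] [y c]/=].
- exact: marginal_density.
- by rewrite card_ord (leq_ltn_trans _ (ltn_ord i0)).
- rewrite /glue AkE !ffunE !eqxx card_ord /=; congr (marg A U _ _ * _).
    by rewrite -[RHS]extendK; apply/eqP/restrP => i iA; rewrite ffunE (negbTE (memPn kA _ iA)).
  by rewrite -[RHS]extendK; apply/eqP/restrP => i iA; rewrite ffunE (negbTE (memPn kA _ iA)).
Qed.

Lemma marginal_entropy_setT U : density U -> vN_entropy (marg setT U) = vN_entropy U.
Proof.
move=> Ud; have [Npsd _] := marginal_density setT Ud.
have rbij : bijective (@restr n d setT).
  exists (@extend setT) => x; last exact: extendK.
  by apply/eqP; rewrite -(restr_full setT) extendK eqxx; apply/restrP => i; rewrite !inE.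
rewrite -(vN_entropy_bij Npsd rbij).
have ME f g : marg setT U (restr setT f) (restr setT g) = U f g.
  have full f' g' : (restr setT f' == restr setT g') = (f' == g').
    by rewrite -(restr_full setT) andb_idr// => _; apply/restrP => i; rewrite !inE.
  rewrite /marginal (bigD1 f)//= (bigD1 g)//= !eqxx /=.
  rewrite (introT (restrP _ _ _)) => [|i]; last by rewrite !inE.
  rewrite big1 => [|g' /negbTE g'g]; last by rewrite !full g'g.
  by rewrite big1 ?addr0// => f' /negbTE f'f; rewrite big1// => g' _; rewrite full f'f.
by apply: eq_vN_entropy => f g; rewrite ME.
Qed.

End Extension.
End Marginals.

(** * Upper bound *)

Section UpperBound.
Variables (R : realType) (n d : nat).
Local Notation marg A U := (@marginal R n d A U).
Local Notation pre := (Defs.prefix n).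
Implicit Types U : op R (full_idx n d).

Lemma prefixS m (mn : (m < 2 * n)%N) : pre m.+1 = Ordinal mn |: pre m.
Proof.
by apply/setP => i; rewrite !inE ltnS leq_eqVlt.
Qed.

Lemma prefix_full : pre (2 * n) = setT.
Proof. by apply/setP => i; rewrite !inE ltn_ord. Qed.

Lemma pair_jE j (hj : (1 <= j <= n)%N) :
  exists a b : 'I_(2 * n), [/\ nat_of_ord a = (2 * j - 2)%N,
    nat_of_ord b = (2 * j - 1)%N & pair_j n j = [set a; b]].
Proof.
have ha : (2 * j - 2 < 2 * n)%N by lia.
have hb : (2 * j - 1 < 2 * n)%N by lia.
by exists (Ordinal ha), (Ordinal hb); split=> //; apply/setP => i; rewrite !inE.
Qed.

Lemma card_pair_idx j : (1 <= j <= n)%N -> #|{: sub_idx d (pair_j n j)}| = (d ^ 2)%N.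
Proof.
move=> hj; have [a [b [ea eb ->]]] := pair_jE hj; rewrite card_ffun card_ord card_sig; congr (_ ^ _)%N.
transitivity #|[set a; b]|; first by apply: eq_card => i; rewrite !inE.
by rewrite cards2 -val_eqE /= ea eb; lia.
Qed.

Hypothesis d_gt0 : (0 < d)%N.

Lemma pair_entropy_le U j : density U -> (1 <= j <= n)%N ->
  vN_entropy (marg (pair_j n j) U) <= 2 * ln d%:R.
Proof.
move=> Ud hj; apply: le_trans (vN_entropy_le (marginal_density _ Ud)) _.
by rewrite card_pair_idx// natrX lnXn ?ltr0n// mulr_natl.
Qed.

Lemma prefix_entropy_step U j : process_tensor U -> (1 <= j <= n)%N ->
  vN_entropy (marg (pre (2 * j - 2)) U) <= vN_entropy (marg (pre (2 * j)) U).
Proof.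
move=> [Ud Uc] hj.
(* Factor 2j-2 is the input i_{j-1} and factor 2j-1 is the output o_j; each extends a prefix by
   one. *)
have ha : (2 * j - 2 < 2 * n)%N by lia.
have hb : (2 * j - 1 < 2 * n)%N by lia.
have pa : pre (2 * j - 1) = Ordinal ha |: pre (2 * j - 2).
  by rewrite -prefixS; congr pre; lia.
have pb : pre (2 * j) = Ordinal hb |: pre (2 * j - 1).
  by rewrite -prefixS; congr pre; lia.
have na : Ordinal ha \notin pre (2 * j - 2) by rewrite inE ltnn.
have nb : Ordinal hb \notin pre (2 * j - 1) by rewrite inE ltnn.
have mixed : vN_entropy (marg (pre (2 * j - 1)) U) =
             vN_entropy (marg (pre (2 * j - 2)) U) + ln d%:R.
  rewrite pa; apply: (marginal_entropy_mixed (Ordinal d_gt0) Ud na) => f g.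
  have := Uc j hj f g; rewrite pa => ->; congr (_ * (_%:R / _)); congr nat_of_bool.
  apply/forallP/eqP => [/(_ (Ordinal ha))|fg k].
    by rewrite eqxx => /eqP.
  by apply/implyP => /eqP ka; apply/eqP; have -> : k = Ordinal ha by apply: val_inj.
have := marginal_entropy_setU1 (Ordinal d_gt0) Ud nb; rewrite -pb mixed.
by rewrite lerD2r.
Qed.

Lemma first_entropy_le U : process_tensor U -> (1 <= n)%N ->
  vN_entropy (marg (pair_j n 1) U) <= vN_entropy U.
Proof.
move=> Up n1; have [Ud _] := Up.
rewrite -(marginal_entropy_setT (Ordinal d_gt0) Ud) -prefix_full.
have -> : pair_j n 1 = pre (2 * 1).
  by apply/setP => i; rewrite !inE; case: (nat_of_ord i) => [|[|k]].
suff mono m : (1 <= m <= n)%N ->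
  vN_entropy (marg (pre (2 * 1)) U) <= vN_entropy (marg (pre (2 * m)) U).
  by apply: mono; rewrite n1 leqnn.
elim: m => // -[_ /andP[_ m1]|m IH /andP[_ mn]]; first by [].
apply: le_trans (IH _) _; first by lia.
(* The prefix ending after step m+1 is the one on which step m+2 starts. *)
have -> : (2 * m.+1 = 2 * m.+2 - 2)%N by lia.
exact: prefix_entropy_step.
Qed.

Lemma non_markovianity_le U : process_tensor U -> (1 <= n)%N ->
  non_markovianity U <= 2 * (n - 1)%:R * ln (d%:R : R).
Proof.
move=> Up n1; have [Ud _] := Up; rewrite /non_markovianity big_ltn//.
(* The term S_1 is set against S_{1:n}, which leaves the n - 1 terms with j >= 2. *)
rewrite addrAC -lerBrDl opprB.
have := first_entropy_le Up n1; set S1 := vN_entropy (marg _ U) => S1U.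
apply: (@le_trans _ _ (\sum_(2 <= j < n.+1) 2 * ln (d%:R : R))).
  apply: (@le_trans _ _ (\sum_(2 <= j < n.+1) vN_entropy (marg (pair_j n j) U))).
    by [].
  by apply: ler_sum_nat => j /andP[j2 jn]; apply: pair_entropy_le => //; lia.
rewrite sumr_const_nat subSS -mulr_natr; lra.
Qed.

End UpperBound.

(** * An extremal process tensor *)

Section Extremal.
Variables (R : realType) (n d : nat).
Hypotheses (n_gt0 : (0 < n)%N) (d_gt0 : (0 < d)%N).
Local Notation C := R[i].
Local Notation idx := (full_idx n d).
Local Notation marg A U := (@marginal R n d A U).
Local Notation pre := (Defs.prefix n).
Local Notation labels := {ffun 'I_n.+1 -> 'I_d}.
Implicit Types (A : {set 'I_(2 * n)}) (f g : idx) (s t : labels) (p : 'I_n.+1).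

(* Factors [2 a] (i_a) and [2 a + 3] (o_{a+2}) share slot [a]; the factor [1]
   (o_1) is alone in slot [n], and [2 (n - 1)] (i_{n-1}) alone in slot [n - 1]. *)
Definition slot (k : 'I_(2 * n)) : 'I_n.+1 :=
  inord (if k == 1%N :> nat then n
         else if (k %% 2 == 0)%N then (k %/ 2)%N else ((k - 3) %/ 2)%N).

Lemma slotE k p : (slot k == p) =
  [|| k == (2 * p)%N :> nat, k == (2 * p + 3)%N :> nat | (k == 1%N :> nat) && (p == n :> nat)].
Proof.
have kn := ltn_ord k; have pn := ltn_ord p.
rewrite -val_eqE /slot /= inordK; first by case: ifP; last case: ifP; lia.
by case: ifP; last case: ifP; lia.
Qed.

(** * The extremal state and its branches *)

Definition pen : 'I_n.+1 := inord n.-1.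

Lemma pen_val : pen = n.-1 :> nat.
Proof. by rewrite inordK // ltnS leq_pred. Qed.

Definition spread s : idx := [ffun k => s (slot k)].

(** Labels in the two one-factor slots must agree between row and column, which makes these slots
    maximally mixed; the other slots stay coherent, hence maximally entangled. *)
Definition same_ends s t := (s ord_max == t ord_max) && (s pen == t pen).

Definition extremal : op R idx := fun f g =>
  (d%:R ^- n.+1) * \sum_s \sum_t
    delta R f (spread s) * (delta R g (spread t) * (same_ends s t)%:R).

Lemma spread_inj : injective spread.
Proof.
move=> s t /ffunP st; apply/ffunP => p; have pn := ltn_ord p.
have [k /eqP <-] : exists k, slot k == p; last by have := st k; rewrite !ffunE.
(* Every slot contains a factor: factor 1 for slot n, factor 2p for slot p < n. *)
have kn : ((if p == n :> nat then 1 else 2 * p) < 2 * n)%N by case: ifP; lia.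
exists (Ordinal kn); rewrite slotE /=; case: ifP; lia.
Qed.

Definition weight : R := (d%:R ^+ n.+1)^-1.

(** One unnormalized pure state per pair of end labels: d^2 vectors in all, whence entropy at most 2
    ln d. *)
Definition branch (ab : 'I_d * 'I_d) f : C :=
  (Num.sqrt weight)%:C%C * \sum_s delta R f (spread s) *
    (delta R ab.1 (s ord_max) * delta R ab.2 (s pen)).

Lemma extremal_branch f g :
  extremal f g = \sum_ab branch ab f * (branch ab g)^*.
Proof.
have wE : (Num.sqrt weight)%:C%C * ((Num.sqrt weight)%:C%C)^* = d%:R ^- n.+1 :> C.
  rewrite conj_real_complex -rmorphM /= -expr2 sqr_sqrtr ?invr_ge0 ?exprn_ge0//.
  by rewrite /weight fmorphV rmorphXn rmorph_nat.
(* Agreement of the end labels is expanded as a sum over their common values, one for each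
   branch. *)
pose ends s t (ab : 'I_d * 'I_d) := delta R (s ord_max) ab.1 * (delta R (s pen) ab.2 *
  (delta R ab.1 (t ord_max) * delta R ab.2 (t pen))).
have endsE s t : \sum_ab ends s t ab = (same_ends s t)%:R.
  rewrite -(pair_bigA _ (fun a b => ends s t (a, b))) /=.
  under eq_bigr => a _ do rewrite /ends /= -mulr_sumr sum_deltal.
  by rewrite sum_deltal /delta -natrM mulnb.
transitivity (\sum_ab d%:R ^- n.+1 * \sum_s \sum_t
    delta R f (spread s) * (delta R g (spread t) * ends s t ab)).
  rewrite -mulr_sumr exchange_big; congr (_ * _); apply: eq_bigr => s _ /=.
  rewrite exchange_big; apply: eq_bigr => t _ /=.
  by rewrite -endsE !mulr_sumr.
apply: eq_bigr => ab _; rewrite /branch rmorphM mulrACA wE rmorph_sum mulr_suml.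
congr (_ * _); apply: eq_bigr => s _; rewrite mulr_sumr; apply: eq_bigr => t _.
rewrite !rmorphM /= !conj_delta /ends ![delta R (s _) _]deltaC; ring.
Qed.

Lemma prod_natb (I : finType) (b : I -> bool) :
  \prod_i (b i)%:R = [forall i, b i]%:R :> C.
Proof.
have [/forallP ball|/forallPn[i /negbTE bi]] := boolP [forall i, b i].
  by rewrite big1// => i _; rewrite ball.
by rewrite (bigD1 i)//= bi mul0r.
Qed.

Lemma trace_extremal : trace extremal = 1.
Proof.
have dn0 : (d%:R : C) != 0 by rewrite pnatr_eq0 -lt0n.
rewrite /trace /extremal -mulr_sumr exchange_big /=.
transitivity ((d%:R : C) ^- n.+1 * \sum_(s : labels) 1); last first.
  rewrite sumr_const card_ffun !card_ord natrX mulVf//.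
  by rewrite expf_neq0.
congr (_ * _); apply: eq_bigr => s _; rewrite exchange_big /=.
transitivity (\sum_t delta R s t * (same_ends s t)%:R).
  apply: eq_bigr => t _; under eq_bigr => f _ do rewrite deltaC.
  by rewrite sum_deltal /delta (inj_eq spread_inj).
by rewrite sum_deltal /same_ends !eqxx.
Qed.

(* The slots on which the two basis labels must coincide once the factors
   outside [A] are traced out. *)
Definition tied A p : bool :=
  [|| p == ord_max, p == pen | [exists (k | k \notin A), slot k == p]].

(** Here [a] and [b] are the row and column labels of slot [p]; the condition involves no other
    slot. *)
Definition slot_ok A f g p (a b : 'I_d) : bool :=
  [forall (k | k \in A), (slot k == p) ==> (f k == a) && (g k == b)] &&
  (tied A p ==> (a == b)).

(** Every constraint on the pair of labelings concerns a single slot, so the double sum over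
    labelings factors into a product over slots. *)
Lemma marginal_extremal A f g :
  marg A extremal (restr A f) (restr A g) =
  d%:R ^- n.+1 * \prod_p \sum_a \sum_b (slot_ok A f g p a b)%:R.
Proof.
pose P f' g' := [&& restr A f' == restr A f, restr A g' == restr A g
                  & restr (~: A) f' == restr (~: A) g'].
transitivity (d%:R ^- n.+1 * \sum_s \sum_t (P (spread s) (spread t))%:R * (same_ends s t)%:R : C).
  rewrite /marginal /extremal.
  transitivity (\sum_f' \sum_g' \sum_s \sum_t d%:R ^- n.+1 *
    (delta R (spread s) f' * (delta R (spread t) g' * ((P f' g')%:R * (same_ends s t)%:R)))).
    apply: eq_bigr => f' _; apply: eq_bigr => g' _; rewrite -/(P f' g').
    case: (P f' g'); last first.
      by rewrite big1// => s _; rewrite big1// => t _; rewrite mul0r !mulr0.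
    rewrite mulr_sumr; apply: eq_bigr => s _; rewrite mulr_sumr; apply: eq_bigr => t _.
    by rewrite mul1r (deltaC _ f') (deltaC _ g').
  under eq_bigr => f' _ do rewrite exchange_big.
  rewrite exchange_big mulr_sumr; apply: eq_bigr => s _ /=.
  under eq_bigr => f' _ do rewrite exchange_big.
  rewrite exchange_big mulr_sumr; apply: eq_bigr => t _ /=.
  under eq_bigr => f' _ do rewrite -!mulr_sumr sum_deltal.
  by rewrite -mulr_sumr sum_deltal.
congr (_ * _); rewrite bigA_distr_bigA; apply: eq_bigr => s _ /=.
rewrite bigA_distr_bigA; apply: eq_bigr => t _ /=.
rewrite prod_natb -natrM mulnb; congr (nat_of_bool _)%:R.
apply/idP/forallP => [/andP[/and3P[/restrP sf /restrP tg /restrP st] /andP[sM sP]] p|H].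
  apply/andP; split.
    apply/forall_inP => k kA; apply/implyP => /eqP <-.
    by rewrite -sf// -tg// !ffunE !eqxx.
  apply/implyP => /or3P[/eqP->//|/eqP->//|/exists_inP[k kA /eqP <-]].
  by have := st k; rewrite !ffunE inE kA => ->.
have agree p : tied A p -> s p = t p.
  by move=> Hp; have /andP[_ /implyP/(_ Hp)/eqP] := H p.
apply/andP; split; last by rewrite /same_ends !agree /tied ?eqxx ?orbT.
have onA k : k \in A -> (f k == s (slot k)) && (g k == t (slot k)).
  move=> kA; have /andP[/forall_inP/(_ k kA)] := H (slot k).
  by rewrite eqxx.
apply/and3P; split; apply/restrP => k kA; rewrite !ffunE.
- by have /andP[/eqP-> _] := onA k kA.
- by have /andP[_ /eqP->] := onA k kA.
- by apply: agree; apply/or3P/Or33/exists_inP; exists k => //; rewrite inE in kA.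
Qed.

(** * Slot factors and causality of the extremal state *)

Definition slot_sum A f g p : C := \sum_a \sum_b (slot_ok A f g p a b)%:R.

(** Nothing is imposed beyond a = b, which leaves d choices. *)
Lemma slot_sum_free A f g p : tied A p -> (forall k, k \in A -> slot k != p) ->
  slot_sum A f g p = d%:R.
Proof.
move=> tA sA; transitivity (\sum_(a < d) (1 : C)).
  apply: eq_bigr => a _; rewrite -[RHS](sum_deltal (fun=> 1) a).
  apply: eq_bigr => b _; rewrite /slot_ok tA mulr1.
  rewrite (introT forall_inP) // => k kA; by rewrite (negbTE (sA k kA)).
by rewrite sumr_const card_ord.
Qed.

(** The single kept factor fixes a = f k and b = g k, and the tie adds a = b. *)
Lemma slot_sum_fixed A f g k : tied A (slot k) -> k \in A ->
  (forall k', k' \in A -> slot k' = slot k -> k' = k) ->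
  slot_sum A f g (slot k) = (f k == g k)%:R.
Proof.
move=> tA kA sA.
transitivity (\sum_a delta R (f k) a * \sum_b delta R a b * delta R b (g k)).
  apply: eq_bigr => a _; rewrite mulr_sumr; apply: eq_bigr => b _.
  rewrite /delta -!natrM !mulnb; congr (nat_of_bool _)%:R.
  rewrite /slot_ok tA /= [a == b]eq_sym [RHS]andbCA [b == a]eq_sym andbC; congr (_ && _).
  apply/forall_inP/andP => [/(_ k kA)|[fa gb] k' k'A].
    by rewrite eqxx (eq_sym b) => /andP.
  by apply/implyP => /eqP/(sA _ k'A) ->; rewrite fa eq_sym.
by rewrite sum_deltal sum_deltal.
Qed.

(** Adjoining i_{j-1} to the prefix affects only slot j - 1. Its partner o_{j+1}, if any, is still
    traced out, so the slot factor turns from d into a Kronecker delta. *)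
Lemma process_tensor_extremal : process_tensor extremal.
Proof.
have dn0 : (d%:R : C) != 0 by rewrite pnatr_eq0 -lt0n.
split=> [|j hj f g].
  split; [exact: ensemble_psd extremal_branch|exact: trace_extremal].
have hk : (2 * j - 2 < 2 * n)%N by lia.
pose k0 := Ordinal hk; pose p0 := slot k0.
have p0E : p0 = (j - 1)%N :> nat.
  have : slot k0 == p0 by [].
  by rewrite slotE /=; lia.
have preE k : (k \in pre (2 * j - 1)) = (k \in pre (2 * j - 2)) || (k == k0).
  by rewrite !inE -val_eqE /=; lia.
(* Arithmetic form of [tied] on prefixes, so that [lia] can decide it. *)
have tied_pre m p : tied (pre m) p = [|| p == n :> nat, p == n.-1 :> nat,
    (2 * p + 3 < 2 * n)%N && (m <= 2 * p + 3)%N,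
    (2 * p < 2 * n)%N && (m <= 2 * p)%N | (p == n :> nat)].
  have pn := ltn_ord p; rewrite /tied -!val_eqE /= pen_val.
  apply/idP/idP => [/or3P[->|->|/exists_inP[k]]|]; rewrite ?orbT//.
    have kn := ltn_ord k; rewrite inE slotE; lia.
  case/or4P => [->|->|/andP[h m1]|]; rewrite ?orbT//.
    apply/or3P/Or33/exists_inP; exists (Ordinal h); first by rewrite inE /= -leqNgt.
    by rewrite slotE /= eqxx orbT.
  case/orP => [/andP[h m1]|->//].
  apply/or3P/Or33/exists_inP; exists (Ordinal h); first by rewrite inE /= -leqNgt.
  by rewrite slotE /= eqxx.
rewrite !marginal_extremal -/(slot_sum _ _ _ _) (bigD1 p0)//= [in RHS](bigD1 p0)//=.
rewrite -/(slot_sum _ _ _ _) -/(slot_sum (pre (2 * j - 2)) _ _ _).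
rewrite (@slot_sum_free (pre (2 * j - 2))); last 2 first.
- by rewrite tied_pre; lia.
- by move=> k; rewrite inE slotE; have := ltn_ord k; lia.
rewrite slot_sum_fixed; last 3 first.
- by rewrite tied_pre -/p0; lia.
- by rewrite preE eqxx orbT.
- move=> k; rewrite preE => /orP[|/eqP//]; rewrite inE => kj /eqP.
  by rewrite slotE -/p0; have := ltn_ord k; lia.
have -> : [forall k : 'I_(2 * n), (k == (2 * j - 2)%N :> nat) ==> (f k == g k)] = (f k0 == g k0).
  apply/forallP/idP => [/(_ k0)|fg k]; first by rewrite eqxx.
  by apply/implyP => /eqP kE; have -> : k = k0 by apply: val_inj.
(* Both prefixes impose the same condition on every other slot; the factor d of the free slot
   cancels the 1/d of causality. *)
set X := \prod_(p | p != p0) _; set Y := \prod_(p | p != p0) _.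
suff -> : X = Y.
  by rewrite -!mulrA; congr (_ * _); rewrite [RHS]mulrC -!mulrA mulVf// mulr1 mulrC.
apply: eq_bigr => p pp0; apply: eq_bigr => a _; apply: eq_bigr => b _.
congr (nat_of_bool _)%:R; congr (_ && (_ ==> _)); last first.
  by rewrite !tied_pre; move: pp0; rewrite -val_eqE /=; lia.
apply/forall_inP/forall_inP => H k kA; first by apply: H; rewrite preE kA.
move: kA; rewrite preE => /orP[|/eqP->]; first exact: H.
by rewrite -/p0 eq_sym (negbTE pp0).
Qed.

(** * Entropies of the extremal state *)

Lemma vN_entropy_mixed (T : finType) (M : op R T) : (0 < #|T|)%N ->
  (forall x y, M x y = delta R x y / #|T|%:R) -> vN_entropy M = ln #|T|%:R.
Proof.
move=> T0 ME; have T1 : 0 < (#|T|%:R : R) by rewrite ltr0n.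
rewrite (@eigenbasis_entropy _ _ T _ (fun=> #|T|%:R^-1) (@delta R T)).
- transitivity (#|T|%:R * eta (#|T|%:R^-1 : R)); first by rewrite sumr_const mulr_natl.
  by rewrite /eta lnV// !mulrN opprK mulrA divff ?mul1r// gt_eqF.
- by move=> _; rewrite invr_ge0 ltW.
- split=> [x y|x y|x y].
  + rewrite /dot; under eq_bigr => z _ do rewrite conj_delta.
    by rewrite sum_deltal deltaC.
  + under eq_bigr => z _ do rewrite conj_delta deltaC.
    by rewrite sum_deltal.
  + under eq_bigr => z _ do rewrite conj_delta -mulrA mulrCA deltaC.
    by rewrite sum_deltal ME fmorphV rmorph_nat mulrC.
Qed.

(** The two factors of a pair lie in different slots, and no shared slot lies inside the pair, so
    every slot is tied and the marginal is maximally mixed. *)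
Lemma pair_entropy_extremal j : (1 <= j <= n)%N ->
  vN_entropy (marg (pair_j n j) extremal) = 2 * ln d%:R.
Proof.
move=> hj; have dn0 : (d%:R : C) != 0 by rewrite pnatr_eq0 -lt0n.
rewrite -[RHS](_ : ln #|{: sub_idx d (pair_j n j)}|%:R = _); last first.
  by rewrite card_pair_idx// natrX lnXn ?ltr0n// mulr_natl.
apply: vN_entropy_mixed => [|x y]; first by rewrite card_pair_idx// expn_gt0 d_gt0.
rewrite card_pair_idx//; have [ka [kb [ea eb pE]]] := pair_jE hj.
rewrite -[x](extendK (Ordinal d_gt0)) -[y](extendK (Ordinal d_gt0)).
set f := extend _ x; set g := extend _ y; rewrite marginal_extremal.
rewrite -/(slot_sum _ _ _ _).
have inP k : (k \in pair_j n j) = (k == ka) || (k == kb) by rewrite pE !inE.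
have tP p : tied (pair_j n j) p.
  have pn := ltn_ord p; rewrite /tied -!val_eqE /= pen_val.
  case: eqVneq => //= pn1; case: eqVneq => //= pn2.
  apply/exists_inP.
  have h1 : (2 * p < 2 * n)%N by lia.
  have h2 : (2 * p + 3 < 2 * n)%N by lia.
  have [hp|hp] := boolP (Ordinal h1 \in pair_j n j); last first.
    by exists (Ordinal h1) => //; rewrite slotE /= eqxx.
  exists (Ordinal h2); last by rewrite slotE /= eqxx orbT.
  by move: hp; rewrite !inE /=; lia.
have ne : slot ka != slot kb.
  have := eqxx (slot ka); have := ltn_ord ka; have := ltn_ord kb.
  by rewrite eq_sym {1}slotE [X in _ -> _ -> _ -> ~~ X]slotE; lia.
have ne' : slot kb != slot ka by rewrite eq_sym.
have uniq_slot k k' : k \in pair_j n j -> k' \in pair_j n j -> slot k' = slot k -> k' = k.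
  rewrite !inP => /orP[]/eqP-> /orP[]/eqP-> // /eqP; rewrite ?(negbTE ne) //.
  by rewrite eq_sym (negbTE ne).
(* The n - 1 remaining slots contribute d each, which reduces the normalization to d^-2. *)
transitivity (d%:R ^- n.+1 * ((f ka == g ka)%:R * ((f kb == g kb)%:R *
   \prod_(p | (p != slot ka) && (p != slot kb)) (d%:R : C)))).
  congr (_ * _); rewrite (bigD1 (slot ka))//= (bigD1 (slot kb))//=.
  rewrite -!/(slot_sum _ _ _ _) !slot_sum_fixed ?inP ?eqxx ?orbT//; last 2 first.
  - by move=> k kA; apply: uniq_slot; rewrite // inP eqxx ?orbT.
  - by move=> k kA; apply: uniq_slot; rewrite // inP eqxx ?orbT.
  do 2 congr (_ * _); apply: eq_bigr => p /andP[pa pb]; apply: slot_sum_free => // k.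
  by rewrite inP => /orP[]/eqP->; rewrite eq_sym.
have dE : (d%:R : C) ^+ n.+1 =
    d%:R * (d%:R * \prod_(p | (p != slot ka) && (p != slot kb)) d%:R).
  rewrite -[in LHS](card_ord n.+1) -prodr_const.
  by rewrite (bigD1 (slot ka))//= (bigD1 (slot kb)).
have prod0 : \prod_(p | (p != slot ka) && (p != slot kb)) (d%:R : C) != 0.
  by apply/prodf_neq0.
rewrite dE; set X := \prod_(_ | _) _ in prod0 *.
have -> : delta R (restr (pair_j n j) f) (restr (pair_j n j) g) =
          (f ka == g ka)%:R * (f kb == g kb)%:R.
  rewrite /delta -natrM mulnb; congr (nat_of_bool _)%:R.
  apply/restrP/andP => [fg|[fa fb] k].
    by split; apply/eqP/fg; rewrite inP eqxx ?orbT.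
  by rewrite inP => /orP[]/eqP->; apply/eqP.
by rewrite natrX; field; rewrite dn0.
Qed.

Lemma extremal_entropy_le : vN_entropy extremal <= 2 * ln d%:R.
Proof.
apply: le_trans (ensemble_entropy_le trace_extremal extremal_branch) _.
by rewrite card_prod card_ord natrM lnM ?posrE ?ltr0n// mulr2n mulrDl mul1r.
Qed.

(** The general bound gives one inequality; for the other, the upper bound on the total entropy
    suffices, so its exact value is never computed. *)
Lemma non_markovianity_extremal :
  non_markovianity extremal = 2 * (n - 1)%:R * ln (d%:R : R).
Proof.
apply/eqP; rewrite eq_le non_markovianity_le//=; last exact: process_tensor_extremal.
rewrite /non_markovianity.
rewrite (eq_big_nat _ _ (F2 := fun=> 2 * ln (d%:R : R))); last first.
  by move=> j hj; apply: pair_entropy_extremal.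
rewrite sumr_const_nat subSS subn0 -[_ *+ n]mulr_natr natrB//.
have := extremal_entropy_le; lra.
Qed.

End Extremal.

Theorem theorem1 (R : realType) (n d : nat) (hn : (1 <= n)%N) (hd : (2 <= d)%N) :
  (forall U : op R (full_idx n d),
      process_tensor U -> non_markovianity U <= 2 * (n - 1)%:R * ln (d%:R : R))
  /\ (exists U : op R (full_idx n d),
      process_tensor U /\ non_markovianity U = 2 * (n - 1)%:R * ln (d%:R : R)).
Proof.
have d_gt0 : (0 < d)%N by rewrite ltnW.
split=> [U Up|]; first exact: non_markovianity_le.
exists (@extremal R n d); split; first exact: process_tensor_extremal.
exact: non_markovianity_extremal.
Qed.
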